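(* Let $G$ be a fully residually free group and let $A$ be any nonempty finite subset of $G$. Then either $|A^3|\ge \frac{1}{7776}|A|^2$ or the subgroup $\langle A\rangle$ generated by $A$ is a free abelian subgroup of $G$.
   Context: A group $G$ is fully residually free if for any list of $k$ distinct elements $g_1,\ldots,g_k\in G$ there is a surjective homomorphism $\theta$ from $G$ to a free group $F$ (which may depend on the list) such that $\theta(g_1),\ldots,\theta(g_k)$ are distinct elements of $F$. (Finitely generated fully residually free groups are also called limit groups.) $A^3=\{a_1a_2a_3 : a_1,a_2,a_3\in A\}$. The trivial group counts as free abelian (of rank $0$). *)

(* Defs.v *)
From HB Require Import structures.
From mathcomp Require Import all_boot all_order all_algebra.
From mathcomp Require Import finmap.
From mathcomp Require Import freeg.

Set Implicit Arguments.
Unset Strict Implicit.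
Unset Printing Implicit Defensive.

Local Open Scope fset_scope.
Local Open Scope group_scope.

(* Groups are the possibly infinite [groupType]s; for these the homomorphisms
   are exactly the functions [{multiplicative G -> H}]. *)

(* Universal property of a free basis [x]. An empty [I] is allowed, so that the
   trivial group is free. *)
Definition is_free_basis (F : groupType) (I : choiceType) (x : I -> F) : Prop :=
  forall (H : groupType) (f : I -> H),
    exists2 phi : {multiplicative F -> H},
      forall i, phi (x i) = f i
      & forall psi : {multiplicative F -> H},
          (forall i, psi (x i) = f i) -> psi =1 phi.

Definition is_free_group (F : groupType) : Prop :=
  exists (I : choiceType) (x : I -> F), is_free_basis x.

Definition fully_residually_free (G : groupType) : Prop :=
  forall s : seq G, uniq s ->
    exists (F : groupType) (theta : {multiplicative G -> F}),
      [/\ is_free_group F,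
          (forall y : F, exists g : G, theta g = y)
        & uniq [seq theta g | g <- s]].

Definition prod_fset (G : groupType) (A B : {fset G}) : {fset G} :=
  [fset a * b | a in A, b in B].

Definition triple_prod (G : groupType) (A : {fset G}) : {fset G} :=
  prod_fset (prod_fset A A) A.

Inductive generated (G : groupType) (A : {fset G}) : G -> Prop :=
| generated_mem a : a \in A -> generated A a
| generated_one : generated A 1
| generated_mul g h : generated A g -> generated A h -> generated A (g * h)
| generated_inv g : generated A g -> generated A g^-1.

(* [S] is the image of an injective homomorphism from the free abelian group
   [{freeg K}] on [K], which is written additively. *)
Definition is_free_abelian_subgroup (G : groupType) (S : G -> Prop) : Prop :=
  exists (K : choiceType) (phi : {freeg K} -> G),
    [/\ (forall u v, phi (u + v)%R = phi u * phi v),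
        injective phi
      & forall g, S g <-> exists u, phi u = g].

(* Main.v *)
Require Import Defs.
From Stdlib Require Import Classical.
From HB Require Import structures.
From mathcomp Require Import all_boot all_order all_algebra.
From mathcomp Require Import finmap.
From mathcomp Require Import freeg zify lra.

Set Implicit Arguments.
Unset Strict Implicit.
Unset Printing Implicit Defensive.
Import GRing.Theory Num.Theory.

(** The reason is that a finite subset [A] of a free group has
    [|A^3| >= |A|^2 / 1024] as soon as two of its elements do not commute
    ([free_tripling]).  If two elements [x], [y] of a finite subset of [G] do not
    commute, residual freeness provides a homomorphism to a free group that is
    injective on [A] and separates [x y] from [y x]; it can only shrink [A^3], so
    the bound holds in [G].  If all elements of [A] commute, the subgroup that
    they generate is abelian, finitely generated and torsion-free (a torsion element
    would survive in a free group, which has none), hence free abelian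
    ([generated_free_abelian]).

    The free group theorem is a statement about overlaps of words.  After a
    conjugation that minimizes the total length of [A] ([min_conj]), no letter
    is too frequent at the ends of the elements of [A], and [A] contains two
    subsets [X] and [Y] of proportional size, possibly equal, such that nothing
    cancels in the products of an element of one by an element of the other, in
    either order ([compatible_subsets]).  Cutting at a median length
    ([median_split]), the elements of [X] may be taken no longer than those of
    [Y].

    Fix [b] in [Y].  If the words [a b c], with [a] and [c] in [X], are distinct
    up to multiplicity two, there are at least [|X|^2 / 2] of them.  If three of
    them coincide, the three prefixes [a] are nested, [b] overlaps two shifted
    copies of itself, and the theorem of Fine and Wilf shows that [b] begins
    with the square of a shortest period word [z] and that the prefixes differ
    by powers of [z] ([collision3]).  Two elements [b], [b'] of [Y] with
    different period words cannot both collide much: if the period word [z'] of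
    [b'] is the longer one, the left factors in [X] that end in [z' z'] take part
    in no triple coincidence for [b], and the other ones in none for [b']
    ([period_word_alternative]).  So either some [b] gives [|X|^2 / 4] products,
    or all the elements of [Y] have the same period word on the left and, by
    reversal, on the right; then [Y] lies in one coset [<z> b0]
    ([sandwich_dichotomy]).

    In the last case take [x] in [A].  If [b0 x] does not commute with [z], then
    the products [z^k (b0 x) z^l] are distinct ([sandwich_inj]), whence [|Y|^2]
    elements in [Y x Y].  If [b0 x] commutes with [z] for every [x] in [A], then
    all of [A] commutes, because commuting is transitive on the nontrivial
    elements of a free group ([commute_trans]). *)

(** * Periods of words *)

Section Words.
Variable T : eqType.
Implicit Types (a b c u v w z : seq T) (p q k n : nat).

Definition wpow z n := iter n (cat z) [::].

Lemma wpowS z n : wpow z n.+1 = z ++ wpow z n.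
Proof. by []. Qed.

Lemma size_wpow z n : size (wpow z n) = n * size z.
Proof. by elim: n => //= n IH; rewrite size_cat IH mulSn. Qed.

Lemma wpowD z m n : wpow z (m + n) = wpow z m ++ wpow z n.
Proof. by elim: m => //= m IH; rewrite IH catA. Qed.

Lemma wpowSr z n : wpow z n.+1 = wpow z n ++ z.
Proof. by rewrite -addn1 wpowD /wpow /= cats0. Qed.

Lemma wpowM z m n : wpow z (m * n) = wpow (wpow z n) m.
Proof. by elim: m => //= m IH; rewrite mulSn wpowD IH. Qed.

Lemma rev_wpow z n : rev (wpow z n) = wpow (rev z) n.
Proof. by elim: n => //= n IH; rewrite rev_cat IH -wpowSr. Qed.

Definition has_period p w := drop p w == take (size w - p) w.

Lemma has_period_rev p w : has_period p (rev w) = has_period p w.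
Proof.
rewrite /has_period drop_rev size_rev take_rev (inj_eq (can_inj revK)) eq_sym.
have [le|lt] := leqP p (size w); first by rewrite subKn.
by rewrite (eqP (ltnW lt : size w - p == 0)) subn0 drop_size take0 drop_oversize // ltnW.
Qed.

Lemma has_period_prefix p w : has_period p w = prefix (drop p w) w.
Proof. by rewrite prefixE size_drop eq_sym. Qed.

Lemma has_period_nth x0 p w :
  has_period p w <-> (forall i, i + p < size w -> nth x0 w i = nth x0 w (i + p)).
Proof.
rewrite /has_period; split=> [/eqP E i lti | H].
  by rewrite addnC -nth_drop E nth_take //; lia.
apply/eqP/(@eq_from_nth _ x0).
  by rewrite size_take size_drop; case: ltnP; lia.
move=> i; rewrite size_drop => lti.
rewrite nth_drop nth_take //.
by rewrite [p + i]addnC -H //; lia.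
Qed.

(** The subtractive step of Euclid's algorithm. An index [i] can be shifted by
    [q - p] either forwards by [q] and back by [p], or in the other order; the
    length bound [p + q <= size w] ensures that one of the two intermediate
    positions is inside the word. *)
Lemma has_period_sub p q w : has_period p w -> has_period q w ->
  p <= q -> p + q <= size w -> has_period (q - p) w.
Proof.
case: w => [|x0 w']; first by rewrite /has_period.
set w := x0 :: w'; move=> /(has_period_nth x0) Hp /(has_period_nth x0) Hq lpq ls.
apply/(has_period_nth x0) => i lti.
have [lt|ge] := ltnP (i + q) (size w).
  rewrite Hq // [RHS]Hp; last lia.
  by congr (nth _ _ _); lia.
have lep : p <= i by lia.
rewrite -{1}(subnK lep) -Hp; last lia.
rewrite Hq; last lia.
by congr (nth _ _ _); lia.
Qed.

(** The weak form of the Fine-Wilf theorem. It yields divisibility among the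
    periods of a word. *)
Lemma fine_wilf p q w : has_period p w -> has_period q w ->
  p + q <= size w -> has_period (gcdn p q) w.
Proof.
have [n] := ubnP (p + q); elim: n => // n IH in p q *; rewrite ltnS => ltn.
wlog lpq : p q ltn / p <= q => [W|] Hp Hq ls.
  have [le|/ltnW le] := leqP p q; first exact: W.
  by rewrite gcdnC; apply: W => //; rewrite addnC.
case: (posnP p) => [->|p0]; first by rewrite gcd0n.
have H := has_period_sub Hp Hq lpq ls.
by rewrite -(subnKC lpq) gcdnDl; apply: (IH p (q - p)) => //; lia.
Qed.

Lemma take_period p w k : has_period p w -> k * p <= size w ->
  take (k * p) w = wpow (take p w) k.
Proof.
move=> /eqP Hp; elim: k => [|k IH] le; first by rewrite mul0n take0.
rewrite mulSn takeD wpowS -IH; last by apply: leq_trans le; rewrite leq_mul2r leqnSn orbT.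
by rewrite Hp take_takel //; lia.
Qed.

Lemma prefix_nested u v w : prefix u w -> prefix v w -> size u <= size v -> prefix u v.
Proof.
rewrite !prefixE => /eqP Eu /eqP Ev le.
by rewrite -{1}Ev take_takel // Eu.
Qed.

Lemma prefix_cat_size u v w : prefix u (v ++ w) -> size u <= size v -> prefix u v.
Proof. by move=> H; apply: prefix_nested H (prefix_prefix _ _). Qed.

(** A word that is a prefix of its own shift by [y] begins with arbitrarily many
    copies of [y]; this is how periods, commutation and overlaps are all turned
    into being a prefix of a power. *)
Lemma prefix_wpow_iter u y n : prefix u (y ++ u) -> prefix u (wpow y n ++ u).
Proof.
move=> H; elim: n => [|n IH]; first exact: prefix_refl.
by apply: prefix_trans H _; rewrite wpowS -catA prefix_catr // eqxx.
Qed.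

Lemma prefix_wpow_size u y n : prefix u (y ++ u) -> size u <= n -> 0 < size y ->
  prefix u (wpow y n).
Proof.
move=> H le y0; apply: prefix_cat_size (prefix_wpow_iter n H) _.
by rewrite size_wpow (leq_trans le) // leq_pmulr.
Qed.

Lemma has_periodE p w : has_period p w = prefix w (take p w ++ w).
Proof. by rewrite -{2}(cat_take_drop p w) prefix_catr // eqxx has_period_prefix. Qed.

Lemma has_period_wpow u y n : prefix u (wpow y n) -> has_period (size y) u.
Proof.
case: n => [|n]; first by rewrite prefixs0 => /eqP ->.
move=> H; rewrite has_period_prefix.
have [le|/ltnW le] := leqP (size u) (size y); first by rewrite drop_oversize ?prefix0s.
have H' := H; move: H'; rewrite wpowS -{1}(cat_take_drop (size y) u).
rewrite prefix_catr ?size_takel // => /andP[_ H'].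
apply: prefix_nested H _; last by rewrite size_drop leq_subr.
by rewrite wpowSr; apply: prefix_catl.
Qed.

(** Words that commute with [z] are prefixes of powers of [z], and so are their
    products; hence [x ++ y] and [y ++ x] are prefixes of equal length of the
    same word. *)
Lemma cat_commute x y z : z != [::] ->
  x ++ z = z ++ x -> y ++ z = z ++ y -> x ++ y = y ++ x.
Proof.
move=> nz Ex Ey.
have z0 : 0 < size z by rewrite lt0n size_eq0.
pose n := size x + size y.
have H u : size u = n -> u ++ z = z ++ u -> prefix u (wpow z n).
  by move=> su E; apply: prefix_wpow_size; rewrite ?su // -E prefix_prefix.
have Hxy : prefix (x ++ y) (wpow z n).
  by apply: H; rewrite ?size_cat // -catA Ey catA Ex catA.
have Hyx : prefix (y ++ x) (wpow z n).
  by apply: H; rewrite ?size_cat 1?addnC // -catA Ex catA Ey catA.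
move: Hxy Hyx; rewrite !prefixE !size_cat (addnC (size y)) => /eqP <- /eqP.
by [].
Qed.

Lemma prefix_same_period_word p u v : 0 < p <= size u -> has_period p u -> has_period p v ->
  take p u = take p v -> size u <= size v -> prefix u v.
Proof.
move=> /andP[p0 le]; rewrite !has_periodE => Hu Hv E les.
have Hs : 0 < size (take p u) by rewrite size_takel.
apply: (@prefix_nested _ _ (wpow (take p u) (size v))) => //.
  exact: prefix_wpow_size.
by rewrite E; apply: prefix_wpow_size => //; rewrite -E.
Qed.

(** Reading backwards from the end of [a ++ wpow z k], the word [w] is a suffix
    of [w ++ wpow z k], hence of a long power of [z]. *)
Lemma suffix_pumping w a z k : 0 < k -> z != [::] -> suffix w a ->
  suffix w (a ++ wpow z k) ->
  has_period (size z) w /\ (size z <= size w -> suffix z w).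
Proof.
move=> k0 z0 /suffixP[s ->] Hw.
have {}Hw : prefix (rev w) (wpow (rev z) k ++ rev w).
  move: Hw; rewrite -prefix_rev -catA rev_cat => /prefix_cat_size.
  by rewrite !size_rev size_cat rev_cat rev_wpow => -> //; apply: leq_addr.
have Hn : prefix (rev w) (wpow (rev z) (size w * k)).
  rewrite wpowM; apply: prefix_wpow_size => //; rewrite ?size_rev //.
  by rewrite size_wpow size_rev muln_gt0 k0 /= lt0n size_eq0.
split; first by rewrite -has_period_rev -(size_rev z); apply: has_period_wpow Hn.
move=> le; rewrite -prefix_rev.
apply: prefix_nested (Hn) _; last by rewrite !size_rev.
case: (size w * k) Hn => [|n _]; last exact: prefix_prefix.
rewrite prefixs0 => /eqP/(congr1 size); rewrite size_rev /= => w0.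
by move: le z0; rewrite w0; case: (z).
Qed.

Lemma minper_exists w : exists p, (0 < p) && has_period p w.
Proof.
exists (size w).+1; rewrite /has_period drop_oversize //.
by have -> : size w - (size w).+1 = 0; [lia | rewrite take0].
Qed.

(** Every [p >= size w] is a period; the least positive one is [1] when [w] is
    empty. *)
Definition minper w := ex_minn (minper_exists w).

Definition period_word w := take (minper w) w.

Lemma minper_gt0 w : 0 < minper w.
Proof. by rewrite /minper; case: ex_minnP => p /andP[]. Qed.

Lemma minper_period w : has_period (minper w) w.
Proof. by rewrite /minper; case: ex_minnP => p /andP[]. Qed.

Lemma minper_min p w : 0 < p -> has_period p w -> minper w <= p.
Proof.
by rewrite /minper; case: ex_minnP => q _ H p0 Hp; apply: H; rewrite p0.
Qed.

(** By Fine-Wilf the greatest common divisor of [q] and the least period is again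
    a period. *)
Lemma minper_dvd q w : has_period q w -> minper w + q <= size w -> minper w %| q.
Proof.
move=> Hq le; apply/gcdn_idPl/eqP; rewrite eqn_leq dvdn_leq ?minper_gt0 ?dvdn_gcdl //=.
apply: minper_min; first by rewrite gcdn_gt0 minper_gt0.
exact: fine_wilf (minper_period w) Hq le.
Qed.

Lemma minper_rev w : minper (rev w) = minper w.
Proof.
suff le u : minper (rev u) <= minper u.
  by apply/eqP; rewrite eqn_leq le -{1}(revK w) le.
by apply: minper_min; rewrite ?minper_gt0 // has_period_rev minper_period.
Qed.

Lemma collision2 a1 a2 b c1 c2 : a1 ++ b ++ c1 = a2 ++ b ++ c2 ->
  size a1 <= size a2 -> size a2 <= size a1 + size b ->
  has_period (size a2 - size a1) b /\ a2 = a1 ++ take (size a2 - size a1) b.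
Proof.
move=> E le12 le; have /prefixP[t Et] : prefix a1 a2.
  by apply: prefix_nested (prefix_prefix a1 (b ++ c1)) _ le12; rewrite E prefix_prefix.
move: E le12 le; rewrite {}Et -!catA size_cat => /eqP.
rewrite eqseq_cat // eqxx /= => /eqP E _; rewrite leq_add2l addKn => le.
have /prefixP[b' Eb] : prefix t b.
  by apply: prefix_nested (prefix_prefix b c1) le; rewrite E prefix_prefix.
have Et : take (size t) b = t by rewrite Eb take_size_cat.
split; last by rewrite Et.
rewrite has_periodE Et; apply: (@prefix_cat_size _ _ c2); last by rewrite size_cat leq_addl.
by rewrite -catA -E prefix_prefix.
Qed.

(** The lengths by which the three copies of [b] are shifted are periods of [b],
    and their sum is at most [size b]. As the least period is at most each of
    them, it is small enough for [minper_dvd] to apply to both. This is why three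
    coincidences are needed: one shift could be nearly as long as [b] and unrelated to
    the least period. *)
Lemma collision3 a1 a2 a3 b c1 c2 c3 :
  a1 ++ b ++ c1 = a2 ++ b ++ c2 -> a2 ++ b ++ c2 = a3 ++ b ++ c3 ->
  size a1 < size a2 -> size a2 < size a3 -> size a3 <= size b ->
  2 * minper b <= size b /\
  exists k1 k2, [/\ 0 < k1, 0 < k2, a2 = a1 ++ wpow (period_word b) k1
                                  & a3 = a2 ++ wpow (period_word b) k2].
Proof.
move=> E12 E23 lt12 lt23 le3.
have [||P1 E1] := collision2 E12; try lia.
have [||P2 E2] := collision2 E23; try lia.
move: P1 P2 E1 E2; set q1 := size a2 - _; set q2 := size a3 - _ => P1 P2 E1 E2.
have m1 : minper b <= q1 by apply: minper_min => //; lia.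
have m2 : minper b <= q2 by apply: minper_min => //; lia.
split; first lia.
have /dvdnP[k1 Ek1] : minper b %| q1 by apply: minper_dvd => //; lia.
have /dvdnP[k2 Ek2] : minper b %| q2 by apply: minper_dvd => //; lia.
exists k1, k2; split.
- by case: k1 Ek1 => //; lia.
- by case: k2 Ek2 => //; lia.
- by rewrite /period_word -take_period ?minper_period // -Ek1 //; lia.
- by rewrite /period_word -take_period ?minper_period // -Ek2 //; lia.
Qed.

Lemma size_le_fibres k (t r : seq T) : {subset t <= r} ->
  {in r, forall y, count_mem y t <= k} -> size t <= k * size r.
Proof.
elim: r t => [|y r IH] t tr Hk.
  by case: t tr {Hk} => // x t /(_ x (mem_head _ _)).
rewrite -(count_predC (pred1 y)) /= mulnS leq_add ?Hk ?mem_head // -size_filter.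
apply: IH => [x|x xr].
  by rewrite mem_filter /= => /andP[xy /tr]; rewrite inE (negPf xy).
apply: leq_trans (Hk x _); last by rewrite inE xr orbT.
by rewrite count_filter sub_count // => ? /andP[].
Qed.

End Words.

(** When [h] separates the points of each fibre of [f], a fibre with three
    elements can be sorted strictly by [h]. For sandwiches below, [h] is the length of the
    left factor. *)
Lemma fibres_le2 (S U : eqType) (f : S -> U) (h : S -> nat) (s : seq S) : uniq s ->
  {in s &, forall x y, f x = f y -> h x = h y -> x = y} ->
  size s <= 2 * size (undup (map f s)) \/
  exists x1 x2 x3, [/\ [/\ x1 \in s, x2 \in s & x3 \in s], f x1 = f x2, f x2 = f x3,
    h x1 < h x2 & h x2 < h x3].
Proof.
move=> Us Hf.
case: (boolP (all (fun y => count_mem y (map f s) <= 2) (undup (map f s)))).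
  move=> /allP H; left; rewrite -(size_map f s); apply: size_le_fibres => // x.
  by rewrite mem_undup.
case/allPn=> y _; rewrite -ltnNge count_map -size_filter; set t := filter _ s => lt3; right.
pose r x x' := h x <= h x'.
have : uniq (sort r t) by rewrite sort_uniq filter_uniq.
have : sorted r (sort r t) by apply: sort_sorted => ? ?; apply: leq_total.
have Ht : {subset sort r t <= [pred x | (f x == y) && (x \in s)]}.
  by move=> x; rewrite mem_sort mem_filter.
rewrite -(size_sort r) in lt3; move: lt3.
case: (sort r t) Ht => [|x1 [|x2 [|x3 t']]] //= Ht _ /and3P[r12 r23 _].
rewrite !inE !negb_or => /and3P[/andP[n12 _] /andP[n23 _] _].
have /andP[/eqP f1 s1] : (f x1 == y) && (x1 \in s) by apply: Ht; rewrite !inE eqxx.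
have /andP[/eqP f2 s2] : (f x2 == y) && (x2 \in s) by apply: Ht; rewrite !inE eqxx orbT.
have /andP[/eqP f3 s3] : (f x3 == y) && (x3 \in s) by apply: Ht; rewrite !inE eqxx !orbT.
exists x1, x2, x3; split; rewrite ?f1 ?f2 ?f3 //.
- by rewrite ltn_neqAle [_ <= _]r12 andbT; apply: contraNneq n12 => e; apply/eqP/Hf; rewrite ?f1 ?f2.
- by rewrite ltn_neqAle [_ <= _]r23 andbT; apply: contraNneq n23 => e; apply/eqP/Hf; rewrite ?f3 ?f2.
Qed.

(** * Coincidences among the words a b c *)

Section Dichotomy.
Variable T : eqType.
Implicit Types (a b c u v w z : seq T) (X Y : seq (seq T)).

Definition sandwich X Y b := undup [seq a ++ b ++ c | a <- X, c <- Y].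

Lemma size_sandwich_sub X X' Y b : {subset X <= X'} ->
  size (sandwich X Y b) <= size (sandwich X' Y b).
Proof.
move=> sX; apply: uniq_leq_size; first exact: undup_uniq.
move=> g; rewrite !mem_undup => /allpairsP[[a c] /= [aX cY ->]].
by apply/allpairsP; exists (a, c); split=> //; apply: sX.
Qed.

Lemma size_sandwich_rev X b :
  size (sandwich (map rev X) (map rev X) (rev b)) <= size (sandwich X X b).
Proof.
rewrite -(size_map rev (sandwich X X b)).
apply: uniq_leq_size; first exact: undup_uniq.
move=> g; rewrite mem_undup => /allpairsP[[a c] /= [/mapP[a' a'X ->] /mapP[c' c'X ->] ->]].
rewrite -!rev_cat map_f // mem_undup -catA; apply/allpairsP.
by exists (c', a').
Qed.

Lemma sandwich_alternative X X' b : uniq X -> uniq X' ->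
  {in X, forall a, size a <= size b} ->
  size X * size X' <= 2 * size (sandwich X X' b) \/
  2 * minper b <= size b /\
  exists a1 a2 a3 k1 k2, [/\ a1 \in X, a2 \in X, a3 \in X, 0 < k1 /\ 0 < k2 &
     a2 = a1 ++ wpow (period_word b) k1 /\ a3 = a2 ++ wpow (period_word b) k2].
Proof.
move=> UX UX' leb.
pose s := [seq (a, c) | a <- X, c <- X']; pose f (x : seq T * seq T) := x.1 ++ b ++ x.2.
have Us : uniq s by apply: allpairs_uniq => // -[? ?] [? ?].
have [x y _ _|H|] := @fibres_le2 _ _ f (size \o fst) s Us.
- move: x y => [a c] [a' c']; rewrite /f /= => /eqP E sz; move: E; rewrite eqseq_cat // => /andP[/eqP E].
  by rewrite eqseq_cat // eqxx => /eqP E'; apply/eqP; rewrite xpair_eqE E E' !eqxx.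
- by left; move: H; rewrite size_allpairs /sandwich map_allpairs.
case=> [[a1 c1] [[a2 c2] [[a3 c3]]]] [[]].
rewrite /f /= => /allpairsP[[? ?] /= [m1 _ [-> _]]] /allpairsP[[? ?] /= [m2 _ [-> _]]].
move=> /allpairsP[[? ?] /= [m3 _ [-> _]]] E12 E23 lt12 lt23; right.
have [le [k1 [k2 [k10 k20 E1 E2]]]] := collision3 E12 E23 lt12 lt23 (leb _ m3).
by split=> //; do 5 eexists; split; [exact: m1|exact: m2|exact: m3|split|split; eassumption].
Qed.

(** Let [z], [z'] be the two period words and [w = z' z']. Since both [a1] and
    [a1 z^k] end in [w], the word [w] has period [size z] besides [size z'], and
    these add up to at most [size w]. So their greatest common divisor [d] is a
    period of [w], hence of [b'], which is a prefix of a power of [z']. Minimality of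
    [size z'] forces [d = size z'], then [size z = size z'], and [z], [z'] are
    suffixes of [w] of the same length. *)
Lemma same_period_word b b' a1 k a2 : 2 * minper b <= size b -> 2 * minper b' <= size b' ->
  minper b <= minper b' -> 0 < k -> a2 = a1 ++ wpow (period_word b) k ->
  suffix (wpow (period_word b') 2) a1 -> suffix (wpow (period_word b') 2) a2 ->
  period_word b = period_word b'.
Proof.
move=> le le' lep k0 -> s1 s2.
have p0 := minper_gt0 b; have p0' := minper_gt0 b'.
have sz : size (period_word b) = minper b by rewrite size_takel //; lia.
have sz' : size (period_word b') = minper b' by rewrite size_takel //; lia.
have nz : period_word b != [::] by rewrite -size_eq0 sz; lia.
have [] := suffix_pumping k0 nz s1 s2.
rewrite size_wpow sz sz' => Pp /(_ ltac:(lia)) sfx.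
have Ew : wpow (period_word b') 2 = take (2 * minper b') b'.
  by rewrite take_period ?minper_period.
have Pp' : has_period (minper b') (wpow (period_word b') 2).
  by rewrite -{1}sz'; apply: (@has_period_wpow _ _ _ 2); apply: prefix_refl.
have Pd := fine_wilf Pp Pp'; rewrite size_wpow sz' in Pd.
have {Pd}Pd := Pd ltac:(lia).
set d := gcdn _ _ in Pd.
have d0 : 0 < d by rewrite gcdn_gt0 p0.
have Er : period_word b' = wpow (take d (wpow (period_word b') 2)) (minper b' %/ d).
  have Ek : minper b' %/ d * d = minper b' by rewrite divnK // dvdn_gcdr.
  rewrite -take_period // Ek; last by rewrite size_wpow sz'; lia.
  by rewrite Ew take_takel //; lia.
have Pb : has_period d b'.
  have sd : size (take d (wpow (period_word b') 2)) = d.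
    rewrite size_takel // size_wpow sz'.
    by have := dvdn_leq p0' (dvdn_gcdr (minper b) (minper b')); lia.
  rewrite -[d in has_period d]sd.
  apply: (@has_period_wpow _ _ _ (size b' * (minper b' %/ d))).
  rewrite wpowM -Er; apply: prefix_wpow_size => //; last by rewrite sz'.
  by rewrite -has_periodE minper_period.
have Ed : d = minper b'.
  by apply/eqP; rewrite eqn_leq minper_min // dvdn_leq ?dvdn_gcdr.
have Epp : minper b = minper b'.
  by apply/eqP; rewrite eqn_leq lep -Ed dvdn_leq ?dvdn_gcdl.
have sfx' : suffix (period_word b') (wpow (period_word b') 2) by rewrite wpowSr suffix_suffix.
move: sfx sfx'; rewrite !suffixE sz sz' Epp => /eqP E /eqP E'.
exact: etrans (esym E) E'.
Qed.

(** Take two middle words with different period words [z], [z'], with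
    [size z <= size z'], and split [X] according to whether an element ends in
    [z' z']. In a triple coincidence for [b'] the longest left factor ends in
    [z' z'], so that the elements of the second kind collide at most in pairs
    for [b']. By [same_period_word] a triple coincidence for [b] cannot have two
    left factors of the first kind. One of the two kinds makes up half of [X]. *)
Lemma period_word_alternative X Y : uniq X -> {in X & Y, forall a b, size a <= size b} ->
  (exists2 b, b \in Y & size X ^ 2 <= 4 * size (sandwich X X b)) \/
  {in Y, forall b, 2 * minper b <= size b} /\ {in Y &, forall b b', period_word b = period_word b'}.
Proof.
move=> UX le.
case: (boolP (has (fun b => size X ^ 2 <= 4 * size (sandwich X X b)) Y)).
  by case/hasP=> b bY Hb; left; exists b.
move=> /hasPn Hn; right.
have leX b : b \in Y -> {in X, forall a, size a <= size b}.
  by move=> bY a aX; apply: le.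
have Hlong : {in Y, forall b, 2 * minper b <= size b}.
  move=> b bY; have [H|[]//] := sandwich_alternative UX UX (leX b bY).
  by have := Hn b bY; rewrite -ltnNge -mulnn; lia.
split=> //.
suff W : {in Y &, forall b b', minper b <= minper b' -> period_word b = period_word b'}.
  move=> b b' bY bY'; have [/W->//|/ltnW/W H] := leqP (minper b) (minper b').
  by rewrite H.
move=> b b' bY bY' lep; apply/eqP/negPn/negP => nr.
pose sq a := suffix (wpow (period_word b') 2) a.
have := count_predC sq X; rewrite -!size_filter => Esz.
have sub (P : pred (seq T)) : {subset filter P X <= X}.
  by move=> a; rewrite mem_filter => /andP[].
have [le2|lt2] := leqP (size X) (2 * size (filter (predC sq) X)).
- have [||H|] := @sandwich_alternative (filter (predC sq) X) X b' _ UX.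
  + exact: filter_uniq.
  + by move=> a /sub; apply: leX.
  + have := Hn b' bY'; rewrite -ltnNge -mulnn.
    by have := size_sandwich_sub X b' (sub (predC sq)); nia.
  case=> _ [a1 [a2 [a3 [k1 [k2 [_ _ m3 [k10 k20] [E1 E2]]]]]]].
  move: m3; rewrite mem_filter => /andP[/negP nsq _]; case: nsq.
  have Ek : k1 + k2 = (k1 + k2 - 2) + 2 by lia.
  by rewrite /sq E2 E1 -catA -wpowD Ek wpowD catA suffix_suffix.
- have [||H|] := @sandwich_alternative (filter sq X) X b _ UX.
  + exact: filter_uniq.
  + by move=> a /sub; apply: leX.
  + have := Hn b bY; rewrite -ltnNge -mulnn.
    by have := size_sandwich_sub X b (sub sq); nia.
  case=> _ [a1 [a2 [a3 [k1 [k2 [m1 m2 _ [k10 _] [E1 _]]]]]]].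
  move: m1 m2; rewrite !mem_filter => /andP[s1 _] /andP[s2 _].
  by case/eqP: nr; apply: (same_period_word (Hlong b bY) (Hlong b' bY') lep k10 E1 s1 s2).
Qed.

(** The alternative is applied to the words and to their reversals. If the
    period words agree at both ends, the shorter of [b], [b'] is both a prefix and
    a suffix of the longer, so that the difference of their lengths is a period
    of the longer one, and a multiple of the least period. *)
Theorem sandwich_dichotomy X Y : uniq X -> {in X & Y, forall a b, size a <= size b} ->
  (exists2 b, b \in Y & size X ^ 2 <= 4 * size (sandwich X X b)) \/
  {in Y, forall b, prefix (wpow (period_word b) 2) b} /\
  {in Y &, forall b b', size b <= size b' -> exists k, b' = wpow (period_word b) k ++ b}.
Proof.
move=> UX le; have [|[long rootY]] := period_word_alternative UX le; first by left.
have [|||] := @period_word_alternative (map rev X) (map rev Y).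
- by rewrite map_inj_uniq //; apply: can_inj revK.
- by move=> _ _ /mapP[a aX ->] /mapP[b bY ->]; rewrite !size_rev; apply: le.
- case=> _ /mapP[b bY ->]; rewrite size_map => H; left; exists b => //.
  by apply: leq_trans H _; rewrite leq_mul2l size_sandwich_rev.
case=> _ rootY'; right; split=> [b bY|b b' bY bY' les].
  by rewrite -take_period ?minper_period ?long // prefixE size_takel ?long // take_takel.
have Em : minper b = minper b'.
  have := congr1 size (rootY b b' bY bY').
  by rewrite !size_takel //; have := long b bY; have := long b' bY'; lia.
have lb := long b bY.
have le1 : 0 < minper b <= size b by rewrite minper_gt0; lia.
have /prefixP[t Et] : prefix b b'.
  apply: (@prefix_same_period_word _ (minper b)) => //; rewrite ?minper_period //.
    by rewrite Em minper_period.
  by have := rootY b b' bY bY'; rewrite /period_word -Em.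
have /suffixP[t' Et'] : suffix b b'.
  rewrite -prefix_rev; apply: (@prefix_same_period_word _ (minper b)); rewrite ?size_rev //.
  - by rewrite has_period_rev minper_period.
  - by rewrite has_period_rev Em minper_period.
  by have := rootY' _ _ (map_f rev bY) (map_f rev bY'); rewrite /period_word !minper_rev -Em.
have st : size b' = size t' + size b by rewrite Et' size_cat.
have Pd : has_period (size t') b'.
  by rewrite has_period_prefix {1}Et' drop_size_cat // Et prefix_prefix.
have /dvdnP[k Ek] : minper b' %| size t' by apply: minper_dvd => //; lia.
exists k; rewrite {1}Et'; congr (_ ++ _); rewrite (rootY b b') //.
rewrite -take_period ?minper_period // -Ek; last lia.
by rewrite Et' take_size_cat.
Qed.
End Dichotomy.

(** * Choosing subsets *)

Section Splitting.
Variables (S : eqType).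
Implicit Types (A X Y : seq S).

(** View [A] as the edges [s a -- e a] of a multigraph with [size A] edges in
    which every vertex has degree at most [size A], while the degrees add up to
    [2 * size A]. Adding vertices one at a time, the total degree passes from
    [0] to [2 * size A] by steps of at most [size A], so that it cannot jump over the
    interval from [size A / 2] to [3 * size A / 2]. *)
Lemma balanced_bipartition (V : eqType) A (s e : S -> V) :
  (forall t, count (fun a => s a == t) A + count (fun a => e a == t) A <= size A) ->
  exists P : pred V,
    size A <= 2 * (count (fun a => P (s a)) A + count (fun a => P (e a)) A) <= 3 * size A.
Proof.
move=> H; pose deg (P : pred V) := count (fun a => P (s a)) A + count (fun a => P (e a)) A.
suff main (ts : seq V) : size A <= 2 * deg (mem ts) -> exists P, size A <= 2 * deg P <= 3 * size A.
  suff le : size A <= 2 * deg (mem (map s A ++ map e A)) by apply: main le.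
  rewrite /deg.
  rewrite !(@eq_in_count _ _ predT A) ?count_predT; first lia.
    by move=> a aA /=; rewrite mem_cat map_f ?orbT.
  by move=> a aA /=; rewrite mem_cat map_f.
elim: ts => [|t ts IH] le.
  exists pred0; move: le; rewrite /deg /= !count_pred0; lia.
have [/IH//|lt] := leqP (size A) (2 * deg (mem ts)).
exists (mem (t :: ts)); rewrite le /=.
have D : deg (mem (t :: ts)) <= deg (mem ts) + size A.
  have split u : count (fun a => u a \in t :: ts) A
      <= count (fun a => u a == t) A + count (fun a => u a \in ts) A.
    rewrite -count_predUI; apply: leq_trans (leq_addr _ _).
    by apply: sub_count => a /=; rewrite inE.
  by have := H t; have := split s; have := split e; rewrite /deg /=; lia.
lia.
Qed.

(** With respect to a balanced bipartition of the vertices, either an eighth of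
    the edges cross it in the same direction, and these form both [X] and [Y], or
    there are few crossing edges and each side contains at least an eighth of
    the edges, which form [X] and [Y] respectively. *)
Lemma compatible_subsets (V : eqType) A (s e : S -> V) : uniq A ->
  (forall t, count (fun a => s a == t) A + count (fun a => e a == t) A <= size A) ->
  exists X Y, [/\ uniq X /\ uniq Y, {subset X <= A} /\ {subset Y <= A},
    size A <= 8 * size X /\ size A <= 8 * size Y &
    {in X & Y, forall a b, e a != s b /\ e b != s a}].
Proof.
move=> UA /balanced_bipartition[P].
pose PQ Q Q' := [pred a : S | Q (s a) && Q' (e a)].
pose Pc := predC P.
have E1 : count (fun a => P (s a)) A = count (PQ P P) A + count (PQ P Pc) A.
  rewrite -count_predUI [X in _ + X](_ : _ = 0) ?addn0.
    by apply: eq_count => a /=; rewrite -andb_orr orbN andbT.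
  by rewrite (@eq_count _ _ pred0) ?count_pred0 // => a /=; case: (P (e a)); rewrite ?andbF.
have E2 : count (fun a => P (e a)) A = count (PQ P P) A + count (PQ Pc P) A.
  rewrite -count_predUI [X in _ + X](_ : _ = 0) ?addn0.
    by apply: eq_count => a /=; rewrite -andb_orl orbN.
  by rewrite (@eq_count _ _ pred0) ?count_pred0 // => a /=; case: (P (s a)); rewrite ?andbF.
have E3 : count (fun a => ~~ P (s a)) A = count (PQ Pc P) A + count (PQ Pc Pc) A.
  rewrite -count_predUI [X in _ + X](_ : _ = 0) ?addn0.
    by apply: eq_count => a /=; rewrite -andb_orr orbN andbT.
  by rewrite (@eq_count _ _ pred0) ?count_pred0 // => a /=; case: (P (e a)); rewrite ?andbF.
have E4 := count_predC (fun a => P (s a)) A; rewrite [count (predC _) A]E3 in E4.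
rewrite E1 E2 => /andP[le1 le2]; rewrite E1 in E4.
have sub Q : {subset filter Q A <= A} by move=> a; rewrite mem_filter => /andP[].
have fU Q : uniq (filter Q A) by rewrite filter_uniq.
have sep (Q : pred V) u v : Q u -> ~~ Q v -> u != v.
  by move=> Qu; apply: contraNneq => <-.
have [k1|k1] := leqP (size A) (8 * count (PQ P Pc) A).
  exists (filter (PQ P Pc) A), (filter (PQ P Pc) A); split; rewrite ?size_filter //.
  move=> a b; rewrite !mem_filter /= => /andP[/andP[sa ea] _] /andP[/andP[sb eb] _].
  by split; rewrite eq_sym (sep P).
have [k2|k2] := leqP (size A) (8 * count (PQ Pc P) A).
  exists (filter (PQ Pc P) A), (filter (PQ Pc P) A); split; rewrite ?size_filter //.
  move=> a b; rewrite !mem_filter /= => /andP[/andP[sa ea] _] /andP[/andP[sb eb] _].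
  by split; rewrite (sep P).
exists (filter (PQ P P) A), (filter (PQ Pc Pc) A); split; rewrite ?size_filter //.
  by split; lia.
move=> a b; rewrite !mem_filter /= => /andP[/andP[sa ea] _] /andP[/andP[sb eb] _].
by split; [|rewrite eq_sym]; rewrite (sep P).
Qed.

(** Take the least [m] such that half of one of the sets, say [X], satisfies
    [h a <= m]. By minimality fewer than half of the elements of the other one
    satisfy [h a < m]. *)
Lemma median_split (h : S -> nat) X Y : uniq X -> uniq Y ->
  exists X' Y', [/\ uniq X' /\ uniq Y',
    ({subset X' <= X} /\ {subset Y' <= Y} \/ {subset X' <= Y} /\ {subset Y' <= X}),
    minn (size X) (size Y) <= 2 * size X' /\ minn (size X) (size Y) <= 2 * size Y' &
    {in X' & Y', forall a b, h a <= h b}].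
Proof.
move=> UX UY.
pose half Z m := size Z <= 2 * count (fun a => h a <= m) Z.
have ex_m : exists m, half X m || half Y m.
  exists (\max_(a <- X) h a); apply/orP; left; rewrite /half.
  rewrite (@eq_in_count _ _ predT) ?count_predT; first lia.
  by move=> a aX /=; apply: leq_bigmax_seq.
case: (ex_minnP ex_m) => m Hm min_m {ex_m}.
wlog hX : X Y UX UY Hm min_m / half X m => [W|].
  case/orP: (Hm) => [|hY]; first exact: W.
  have [|k Hk|//|X' [Y' [U sub sz le]]] := W Y X UY UX.
  - by rewrite orbC.
  - by apply: min_m; rewrite orbC.
  by exists X', Y'; split=> //; [case: sub; [right|left] | rewrite minnC].
exists (filter (fun a => h a <= m) X), (filter (fun a => m <= h a) Y); split.
- by rewrite !filter_uniq.
- by left; split=> a; rewrite mem_filter => /andP[].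
- rewrite !size_filter; split; first by move: hX; rewrite /half; lia.
  have E := count_predC (fun a => m <= h a) Y.
  case: m min_m {Hm hX} E => [|m] min_m E.
    by move: E; rewrite (@eq_count _ _ predT) ?count_predT //; lia.
  have : ~~ half Y m by apply/negP => hY; have := min_m m; rewrite hY orbT ltnn => /(_ isT).
  rewrite /half -ltnNge; move: E; rewrite (@eq_count _ (predC _) (fun a => h a <= m)); first lia.
  by move=> a /=; rewrite -ltnNge ltnS.
- by move=> a b; rewrite !mem_filter => /andP[le1 _] /andP[le2 _]; apply: leq_trans le1 le2.
Qed.
End Splitting.

(** * The free group of reduced words *)

Local Open Scope group_scope.

Section RawWords.
Variable I : choiceType.
(** The letter [(i, true)] stands for the generator [i], and [(i, false)] for its
    inverse. *)
Definition letter := (I * bool)%type.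
Implicit Types (l m : letter) (u v w : seq letter).

Definition linv l : letter := (l.1, ~~ l.2).

Lemma linvK : involutive linv.
Proof. by case=> i b; rewrite /linv /= negbK. Qed.

Definition freely_reduced w := sorted (fun l m => m != linv l) w.

Definition push l w := if w is m :: w' then if m == linv l then w' else l :: w else [:: l].

(** Free reduction of [u ++ v] when [v] is reduced: the letters of [u] act one
    after the other on reduced words. *)
Definition wmul u v := foldr push v u.

Definition winv u := rev (map linv u).

Lemma push_reduced l w : freely_reduced w -> freely_reduced (push l w).
Proof.
case: w => //= m w Hw; have [_|nm] := eqVneq m (linv l); first exact: path_sorted Hw.
by rewrite /= nm.
Qed.

Lemma wmul_reduced u v : freely_reduced v -> freely_reduced (wmul u v).
Proof. by move=> Hv; elim: u => //= l u; apply: push_reduced. Qed.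

Lemma push_linvK l w : freely_reduced w -> push l (push (linv l) w) = w.
Proof.
case: w => [|m w] /=; first by rewrite eqxx.
rewrite linvK; case: (eqVneq m l) => [->|nm] Hw /=; last by rewrite eqxx.
by case: w Hw => //= n w /andP[/negPf -> _].
Qed.

Lemma push_cons l w : freely_reduced (l :: w) -> push l w = l :: w.
Proof. by case: w => //= m w /andP[/negPf -> _]. Qed.

Lemma wmul_cat u v : freely_reduced (u ++ v) -> wmul u v = u ++ v.
Proof.
elim: u => //= l u IH H; rewrite IH ?push_cons //; exact: path_sorted H.
Qed.

Lemma wmul_catE u v : freely_reduced v -> wmul u v = wmul (u ++ v) [::].
Proof. by move=> Hv; rewrite /wmul foldr_cat -/(wmul v [::]) wmul_cat cats0. Qed.

(** The letters act on reduced words by permutations, with [linv l] acting as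
    the inverse of [l]; hence cancelling inside [u] does not change the action
    of [u]. Associativity follows. *)
Lemma wmul_push l u w : freely_reduced w -> wmul (push l u) w = push l (wmul u w).
Proof.
move=> Hw; case: u => //= m u; case: eqVneq => // ->.
by rewrite push_linvK // wmul_reduced.
Qed.

Lemma wmulA u v w : freely_reduced w -> wmul u (wmul v w) = wmul (wmul u v) w.
Proof. by move=> Hw; elim: u => //= l u IH; rewrite wmul_push // IH. Qed.

Lemma winvK : involutive winv.
Proof. by move=> u; rewrite /winv map_rev revK mapK //; apply: linvK. Qed.

Lemma wmulVw u : wmul (winv u) u = [::].
Proof.
elim: u => //= l u IH; rewrite /winv map_cons rev_cons /wmul foldr_rcons /= linvK eqxx.
exact: IH.
Qed.

Lemma reduced_winv u : freely_reduced u -> freely_reduced (winv u).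
Proof.
rewrite /freely_reduced /winv rev_sorted sorted_map; apply: sub_sorted => l m /=.
by rewrite (inj_eq (inv_inj linvK)); apply: contraNneq => ->; rewrite linvK.
Qed.

Lemma size_winv u : size (winv u) = size u.
Proof. by rewrite size_rev size_map. Qed.

Lemma winv_cat u v : winv (u ++ v) = winv v ++ winv u.
Proof. by rewrite /winv map_cat rev_cat. Qed.

Lemma size_push_le l w : size (push l w) <= (size w).+1.
Proof. by case: w => //= m w; case: ifP => //= _; lia. Qed.

Lemma size_push l w : size (push l w) + 2 * (ohead w == Some (linv l)) = (size w).+1.
Proof. by case: w => //= m w; rewrite [Some m == _]/eq_op /=; case: ifP => //= _; lia. Qed.

Lemma size_wmul_le u v : size (wmul u v) <= size u + size v.
Proof. by elim: u => //= l u IH; apply: leq_trans (size_push_le _ _) _. Qed.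

(** Every cancellation shortens the product, so that additivity of lengths excludes
    cancellation. *)
Lemma wmul_size_cat u v : size (wmul u v) = size u + size v -> wmul u v = u ++ v.
Proof.
elim: u => //= l u IH E; have le := size_wmul_le u v.
have le' := size_push_le l (wmul u v).
have {}IH := IH ltac:(lia); rewrite IH in E *; move: E.
by case: (u ++ v) (size_cat u v) => //= m w Es; case: ifP => //= _; lia.
Qed.

Lemma suffix_behead u : suffix (behead u) u.
Proof. by case: u => //= m u; apply: suffix_cons. Qed.

Lemma suffix_push l w : suffix (behead w) (push l w).
Proof.
case: w => //= m w; case: ifP => _; first exact: suffix_refl.
exact: suffix_trans (suffix_cons _ _) (suffix_cons _ _).
Qed.

(** Each letter of [u] cancels at most one letter of [v]. *)
Lemma suffix_wmul u v : suffix (drop (size u) v) (wmul u v).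
Proof.
elim: u => [|l u IH] /=; first by rewrite drop0 suffix_refl.
apply: suffix_trans (suffix_push l _).
rewrite -addn1 addnC -drop_drop drop1.
case/suffixP: IH => -[|m s] -> /=; first exact: suffix_refl.
exact: suffix_trans (suffix_behead _) (suffix_suffix _ _).
Qed.

(** The first letter of [winv u] is the inverse of the last letter of [u], so
    that the condition says that the two letters meeting at the junction do not
    cancel. All conditions on last letters are phrased in this way below. *)
Lemma reduced_cat u v : freely_reduced u -> freely_reduced v ->
  (ohead (winv u) != ohead v) || (u == [::]) -> freely_reduced (u ++ v).
Proof.
elim/last_ind: u => // u l _.
rewrite /winv map_rcons rev_rcons /= -cats1 (negbTE (_ : u ++ [:: l] != [::])); last by case: u.
rewrite orbF -catA /=; case: v => [|m v] Hu Hv; first by [].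
move=> nsl; have nlm : m != linv l by apply: contraNneq nsl => ->.
case: u Hu => [|k u] /=; first by move=> _; rewrite nlm.
by rewrite !cat_path /= => /and3P[-> -> _]; rewrite nlm.
Qed.

Lemma reduced_prefix u v : prefix u v -> freely_reduced v -> freely_reduced u.
Proof. by move=> /prefixP[w ->] /cat_sorted2[]. Qed.

Lemma reduced_cat_junction u v : u != [::] -> freely_reduced (u ++ v) ->
  ohead (winv u) != ohead v.
Proof.
elim/last_ind: u => // u l _ _; rewrite cat_rcons => /cat_sorted2[_].
rewrite /winv map_rcons rev_rcons /=; case: v => //= m v /andP[nml _].
by apply: contraNneq nml => -[<-].
Qed.

End RawWords.

Record fword (I : choiceType) := Fword { fval :> seq (letter I); fvalP : freely_reduced fval }.

HB.instance Definition _ (I : choiceType) := [isSub for @fval I].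
HB.instance Definition _ (I : choiceType) := [Choice of fword I by <:].

(** Summation of a pointwise estimate of the form of [size_conj_gen]. *)
Lemma sum_count_le (S : Type) (s : seq S) (f h : S -> nat) (p q : pred S) :
  (forall x, f x + 2 * p x + 2 * q x <= (h x).+2) ->
  \sum_(x <- s) f x + 2 * (count p s + count q s) <= \sum_(x <- s) h x + 2 * size s.
Proof.
move=> H; elim: s => [|x s IH]; first by rewrite !big_nil.
by rewrite !big_cons /=; have := H x; lia.
Qed.

Section FreeGroup.
Variable I : choiceType.
Implicit Types (l m : letter I) (x y z g h : fword I).

Definition fone : fword I := @Fword I [::] isT.
Definition fmul x y : fword I := Fword (wmul_reduced x (fvalP y)).
Definition finv x : fword I := Fword (reduced_winv (fvalP x)).

Lemma fmulA : associative fmul.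
Proof. by move=> x y z; apply: val_inj; apply: wmulA (fvalP z). Qed.

Lemma fmul1 : left_id fone fmul.
Proof. by move=> x; apply: val_inj. Qed.

Lemma fmulr1 : right_id fone fmul.
Proof. by move=> x; apply: val_inj; rewrite /= wmul_cat cats0 //; apply: fvalP. Qed.

Lemma fmulV : left_inverse fone finv fmul.
Proof. by move=> x; apply: val_inj; apply: wmulVw. Qed.

Lemma fmulrV : right_inverse fone finv fmul.
Proof. by move=> x; apply: val_inj; rewrite /= -{1}[fval x]winvK wmulVw. Qed.

HB.instance Definition _ := isGroup.Build (fword I) fmulA fmul1 fmulr1 fmulV fmulrV.

Lemma fval1 : fval (1 : fword I) = [::]. Proof. by []. Qed.
Lemma fvalM x y : fval (x * y) = wmul x y. Proof. by []. Qed.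
Lemma fvalV x : fval x^-1 = winv x. Proof. by []. Qed.

Lemma fword_eq1 x : (x == 1) = (size x == 0).
Proof. by rewrite -val_eqE size_eq0. Qed.

Definition gen l : fword I := @Fword I [:: l] isT.

Definition first_letter x := ohead x.

Lemma size_fmul x y : size (x * y) <= size x + size y.
Proof. exact: size_wmul_le. Qed.

Lemma size_finv x : size x^-1 = size x.
Proof. exact: size_winv. Qed.

Lemma fval_cat x y : (first_letter x^-1 != first_letter y) || (x == 1) -> fval (x * y) = x ++ y.
Proof.
move=> H; apply/wmul_cat/reduced_cat; try exact: fvalP.
by rewrite -size_eq0 -fword_eq1.
Qed.

Lemma size_mul_gen l x : size (x * gen l) + 2 * (first_letter x^-1 == Some l) = (size x).+1.
Proof.
rewrite -size_finv -(size_finv x) invgM -[first_letter _]/(ohead (x^-1)).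
by rewrite -{1}[l]linvK -(size_push (linv l)) linvK.
Qed.

(** Conjugating by a letter [l] adds two letters, minus two for each end at which
    the letter cancels. The case of a one-letter word [x = l], which is unchanged
    by the conjugation, is consistent because such a word does not also end in [linv l]. *)
Lemma size_conj_gen l x :
  size (x ^ gen l) + 2 * (first_letter x == Some l) + 2 * (first_letter x^-1 == Some l)
  <= (size x).+2.
Proof.
rewrite conjgE mulgA; have := size_mul_gen l ((gen l)^-1 * x).
have := size_push (linv l) x; rewrite linvK -[push _ _]/(fval ((gen l)^-1 * x)) -/(first_letter x).
have [Ex|nx] := eqVneq (first_letter x) (Some l); last first.
  have := size_mul_gen l x; have := size_fmul (gen l)^-1 (x * gen l).
  by rewrite mulgA size_finv /= !muln0 !addn0; lia.
move=> E1 E2; suff : (first_letter x^-1 == Some l) <= (first_letter ((gen l)^-1 * x)^-1 == Some l).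
  by move: E1 E2; case: (first_letter x^-1 == _); case: (first_letter _^-1 == _) => //= E1 E2 _; lia.
move: Ex; rewrite /first_letter; have -> : fval ((gen l)^-1 * x)^-1 = winv (push (linv l) x) by [].
rewrite fvalV; case: (fval x) => //= m u [->]; rewrite linvK eqxx -cat1s winv_cat.
by case: (winv u) => //=; case: eqP => // -[]; case: (l) => ? [] //= [].
Qed.

(** That is, [z] is nontrivial and nothing cancels in [z * z]: for [z = 1] both
    sides are [None]. *)
Definition cyc_reduced z := first_letter z^-1 != first_letter z.

Lemma cyc_reduced_neq1 z : cyc_reduced z -> z != 1.
Proof. by apply: contraNneq => ->; rewrite invg1. Qed.

Lemma first_pow z n : cyc_reduced z -> first_letter (z ^+ n.+1) = first_letter z /\
  fval (z ^+ n.+1) = wpow z n.+1.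
Proof.
move=> cz; elim: n => [|n [IHf IH]]; first by rewrite expg1 /wpow /= cats0.
have E : fval (z ^+ n.+2) = z ++ fval (z ^+ n.+1).
  by rewrite expgS fval_cat // IHf [_ != _]cz.
split; last by rewrite E IH.
by have := cyc_reduced_neq1 cz; rewrite fword_eq1 /first_letter E; case: (fval z).
Qed.

Lemma fval_pow z n : cyc_reduced z -> fval (z ^+ n) = wpow z n.
Proof. by case: n => // n /(@first_pow z n)[]. Qed.

Lemma size_pow z n : cyc_reduced z -> size (z ^+ n) = (n * size z)%N.
Proof. by move=> cz; rewrite fval_pow // size_wpow. Qed.

(** Choose [g] minimizing the total length of the conjugates. A further conjugation by
    a letter [l] must not decrease it, and by [size_conj_gen] this bounds the
    number of ends at which [l] would cancel. *)
Lemma min_conj (s : seq (fword I)) : exists g, forall l,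
  count (fun x => first_letter (x ^ g) == Some l) s
  + count (fun x => first_letter (x ^ g)^-1 == Some l) s <= size s.
Proof.
pose E g := \sum_(x <- s) size (x ^ g)%g.
pose deg g l := count (fun x => first_letter (x ^ g) == Some l) s
  + count (fun x => first_letter (x ^ g)^-1 == Some l) s.
have step g l : E (g * gen l) + 2 * deg g l <= E g + 2 * size s.
  apply: sum_count_le => x; rewrite conjgM; exact: size_conj_gen.
suff: forall n g, E g <= n -> exists g, forall l, deg g l <= size s.
  by move/(_ _ 1 (leqnn _)).
elim=> [|n IH] g len.
  by exists g => l; have := step g l; lia.
(* There may be infinitely many letters; only those in [L] matter. *)
pose L := flatten [seq fval (x ^ g) ++ fval (x ^ g)^-1 | x <- s].
case: (boolP (has (fun l => size s < deg g l) L)) => [/hasP[l _ lt]|/hasPn Hn].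
  by apply: (IH (g * gen l)); have := step g l; lia.
exists g => l; have [/Hn|lL] := boolP (l \in L); first by rewrite -leqNgt.
have first_mem y : first_letter y = Some l -> l \in fval y.
  by rewrite /first_letter; case: (fval y) => //= m u [->]; apply: mem_head.
rewrite /deg (@eq_in_count _ _ pred0) ?(@eq_in_count _ (fun x => _ (_^-1) == _) pred0) ?count_pred0 //.
  move=> x xs /=; apply: contraNF lL => /eqP/first_mem lx.
  by apply/flatten_mapP; exists x; rewrite // mem_cat lx orbT.
move=> x xs /=; apply: contraNF lL => /eqP/first_mem lx.
by apply/flatten_mapP; exists x; rewrite // mem_cat lx.
Qed.

Lemma conj_cyc_reduced x : x != 1 -> exists g, cyc_reduced (x ^ g).
Proof.
move=> nx; have [g Hg] := min_conj [:: x]; exists g.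
have ny : x ^ g != 1 by rewrite conjg_eq1.
have {}Hg l : (first_letter (x ^ g) == Some l) + (first_letter (x ^ g)^-1 == Some l) <= 1.
  by have := Hg l; rewrite /= !addn0.
move: Hg ny; rewrite fword_eq1 /cyc_reduced; move: (x ^ g) => y Hg.
case E: (fval y) => [|l u] // _; have Ef : first_letter y = Some l by rewrite /first_letter E.
by have := Hg l; rewrite Ef eqxx; case: eqP.
Qed.

(** Multiplying [g] by a large power of [z] turns commutation in the group into
    commutation of words: [g'] ends in [z] since [g] can only destroy [size g] letters
    of the power, hence [g' * z] is a concatenation, and then so is [z * g'],
    which has the same length. *)
Lemma cyc_commute_normal z g : cyc_reduced z -> commute g z ->
  exists n, fval (g * z ^+ n) ++ fval z = fval z ++ fval (g * z ^+ n).
Proof.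
move=> cz cgz; exists (size g).+1; set g' := g * _.
have z0 : 0 < size z by rewrite lt0n -fword_eq1 cyc_reduced_neq1.
have /suffixP[s Es] : suffix z g'.
  apply: suffix_trans (suffix_wmul g (fval (z ^+ (size g).+1))).
  rewrite fval_pow // wpowSr drop_cat size_wpow.
  case: ltnP => [_|le]; first exact: suffix_suffix.
  have -> : size g - size g * size z = 0 by nia.
  by rewrite drop0 suffix_refl.
have Ef : first_letter g'^-1 = first_letter z^-1.
  by rewrite /first_letter !fvalV Es winv_cat; case: (winv z) (size_winv z) z0 => //= <-.
have E1 : fval (g' * z) = fval g' ++ fval z by rewrite fval_cat // Ef [_ != _]cz.
have cg'z : g' * z = z * g'.
  by apply/esym/commuteM; [apply/commute_sym | apply: commuteX].
rewrite -E1 cg'z; apply: wmul_size_cat.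
by rewrite -fvalM -cg'z E1 size_cat addnC.
Qed.

Lemma commute_cat x y : fval x ++ fval y = fval y ++ fval x -> commute x y.
Proof.
move=> E; apply: val_inj.
by apply: etrans (wmul_catE _ (fvalP y)) _; rewrite E -wmul_catE //; apply: fvalP.
Qed.

(** Commutative transitivity. After conjugation [z] is cyclically reduced; up to
    powers of [z], the elements [x] and [y] commute with [z] as words, and therefore with
    each other by [cat_commute]. *)
Lemma commute_trans x y z : z != 1 -> commute x z -> commute y z -> commute x y.
Proof.
wlog cz : x y z / cyc_reduced z => [W nz xz yz|_ xz yz].
  have [g cg] := conj_cyc_reduced nz.
  apply: (conjg_inj g); rewrite !conjMg; apply: (W _ _ _ cg).
  - exact: cyc_reduced_neq1.
  - by rewrite /commute -!conjMg xz.
  - by rewrite /commute -!conjMg yz.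
have [k Ek] := cyc_commute_normal cz xz; have [n En] := cyc_commute_normal cz yz.
have nz : fval z != [::] by rewrite -size_eq0 -fword_eq1 cyc_reduced_neq1.
have Exy := cat_commute nz Ek En.
have : commute (x * z ^+ k) (y * z ^+ n).
  exact: commute_cat.
have zn y' i : commute y' z -> commute y' (z ^+ i) by apply: commuteX.
move=> C; apply: (mulIg (z ^+ k * z ^+ n)).
have -> : x * y * (z ^+ k * z ^+ n) = (x * z ^+ k) * (y * z ^+ n).
  by rewrite -!mulgA; congr (x * _); rewrite !mulgA (zn _ k yz).
rewrite C -!mulgA; congr (y * _); rewrite -!expgnDr addnC expgnDr !mulgA.
by rewrite (zn _ n xz) -mulgA.
Qed.

Lemma pow_eq1 x n : x ^+ n.+1 = 1 -> x = 1.
Proof.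
move=> E; apply/eqP/negPn/negP => nx; have [g cg] := conj_cyc_reduced nx.
have := size_pow n.+1 cg; rewrite -conjXg E conj1g fval1 /=.
by have := cyc_reduced_neq1 cg; rewrite fword_eq1; case: size.
Qed.

(** Conjugate elements have the same rate of growth of lengths of powers:
    conjugation by [y] changes lengths by at most [2 * size y]. *)
Lemma conj_growth (u v y : fword I) (p q : nat) : (forall n, size (u ^+ n) = (n * p)%N) ->
  (forall n, size (v ^+ n) = (n * q)%N) -> u * y = y * v -> p = q.
Proof.
move=> Hu Hv E.
have En n : u ^+ n * y = y * v ^+ n.
  by elim: n => [|n IH]; rewrite ?expg0 ?mulg1 ?mul1g // !expgS -mulgA IH mulgA E mulgA.
have l1 n : n * p <= n * q + 2 * size y.
  have := size_fmul (y * v ^+ n) y^-1; rewrite -En mulgK Hu En size_finv.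
  by have := size_fmul y (v ^+ n); rewrite Hv; lia.
have l2 n : n * q <= n * p + 2 * size y.
  have := size_fmul y^-1 (u ^+ n * y); rewrite En mulKg Hv -En size_finv.
  move=> le; apply: leq_trans le _.
  by apply: leq_trans (leq_add (leqnn _) (size_fmul _ _)) _; rewrite Hu; lia.
by have := l1 (2 * size y).+1; have := l2 (2 * size y).+1; nia.
Qed.

Lemma cyc_pow_conj z y i j : cyc_reduced z -> z ^+ i * y = y * z ^+ j -> i = j.
Proof.
move=> cz E; have z0 : 0 < size z by rewrite lt0n -fword_eq1 cyc_reduced_neq1.
suff: (i * size z = j * size z)%N by move/eqP; rewrite eqn_pmul2r // => /eqP.
by apply: (@conj_growth (z ^+ i) (z ^+ j) y) => // n; rewrite -expgnA size_pow //; lia.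
Qed.

Lemma cyc_pow_conjV z y i j : cyc_reduced z -> z ^+ i * y * z ^+ j = y -> i = j.
Proof.
move=> cz E; have z0 : 0 < size z by rewrite lt0n -fword_eq1 cyc_reduced_neq1.
suff: (i * size z = j * size z)%N by move/eqP; rewrite eqn_pmul2r // => /eqP.
apply: (@conj_growth (z ^+ i) (z ^- j) y) => [n|n|]; last by rewrite -{2}E mulgK.
  by rewrite -expgnA size_pow //; lia.
by rewrite expVgn size_finv -expgnA size_pow //; lia.
Qed.

(** A coincidence yields [z^i y = y z^j] or [z^i y z^j = y], and comparing
    growth gives [i = j]. In the first case [y] commutes with [z^i]. In the second
    it conjugates [z^i] to its inverse, so that [y * y] commutes with [z^i],
    hence so does [y]. If [i] is positive, then [y] commutes with [z] by
    transitivity. *)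
Lemma sandwich_inj z y : cyc_reduced z -> ~ commute y z ->
  forall k k' l l' : nat, z ^+ k * y * z ^+ l = z ^+ k' * y * z ^+ l' -> k = k' /\ l = l'.
Proof.
move=> cz ncyz.
have nzi i : z ^+ i.+1 != 1.
  by apply: contra_neq (cyc_reduced_neq1 cz) => /pow_eq1.
have czi i : commute z (z ^+ i) by apply: commuteX.
have ncyzi i : ~ commute y (z ^+ i.+1).
  by move=> c; apply: ncyz; apply: commute_trans (nzi i) c (czi _).
move=> k k' l l'; wlog le : k k' l l' / k <= k' => [W|].
  have [le|/ltnW le] := leqP k k'; first exact: W.
  by move/esym/(W _ _ _ _ le) => [-> ->].
rewrite -(subnKC le) expgnDr -!mulgA => /mulgI; set i := k' - k => E.
suff [-> ->] : i = 0 /\ l = l' by rewrite addn0.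
have [le'|/ltnW le'] := leqP l' l.
  move: E; rewrite -(subnK le') expgnDr !mulgA => /mulIg; set j := l - l' => E.
  have Eij := cyc_pow_conj cz (esym E); rewrite -Eij in E *.
  by case: i E {Eij} => [|i] // /ncyzi.
move: E; rewrite -(subnK le') expgnDr !mulgA => /mulIg; set j := l' - l => /esym E.
have Eij := cyc_pow_conjV cz E; rewrite -Eij in E *.
case: i E {Eij} => [|i] // E.
have E1 : z ^+ i.+1 * y = y * z ^- i.+1 by rewrite -{2}E mulgK.
have E2 : z ^- i.+1 * y = y * z ^+ i.+1.
  by apply: (mulgI (z ^+ i.+1)); rewrite mulVKg !mulgA E.
have Cyy : commute (z ^+ i.+1) (y * y).
  by rewrite /commute mulgA E1 -!mulgA E2.
have ny : y != 1.
  by apply/eqP => Ey; apply: ncyz; rewrite Ey; apply/commute_sym/commute1.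
have nyy : y * y != 1.
  by apply: contra_neq ny; rewrite -expg2 => /pow_eq1.
case: (ncyzi i); apply: commute_trans nyy _ Cyy.
by apply: commuteM.
Qed.
End FreeGroup.

(** The universal property sends the basis to the one-letter words; evaluating
    words in [F] is a left inverse, since the composite fixes the basis and
    uniqueness makes it the identity. *)
Lemma free_group_embedding (F : groupType) : is_free_group F ->
  exists (I : choiceType) (phi : {multiplicative F -> fword I}), injective phi.
Proof.
case=> I [x Hx]; exists I.
have [phi Hphi _] := Hx (fword I) (fun i => gen (i, true)).
exists phi.
pose ev1 (l : letter I) := if l.2 then x l.1 else (x l.1)^-1.
pose ev (w : fword I) := \prod_(l <- fval w) ev1 l.
have ev_push l w : \prod_(m <- push l w) ev1 m = ev1 l * \prod_(m <- w) ev1 m.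
  case: w => [|m w] /=; rewrite ?big_cons ?big_nil //.
  case: eqP => [->|_]; last by rewrite !big_cons.
  rewrite mulgA.
  have -> : ev1 l * ev1 (linv l) = 1.
    by case: l => i [] /=; rewrite /ev1 /= ?mulgV ?mulVg.
  by rewrite mul1g.
have evM : {morph ev : u v / u * v}.
  move=> u v; rewrite /ev fvalM; elim: (fval u) => [|l w IH] /=.
    by rewrite big_nil mul1g.
  by rewrite ev_push IH big_cons mulgA.
pose evm : {multiplicative fword I -> F} := HB.pack ev (isMultiplicative.Build _ _ ev evM).
have [id' _ uniq_id] := Hx F x.
have Ev : (evm \o phi) =1 id'.
  by apply: (uniq_id (evm \o phi)) => i; rewrite /= Hphi /ev big_seq1.
have Ei : idfun =1 id' by apply: uniq_id.
by apply: (can_inj (g := evm)) => y; rewrite -[RHS]/(idfun y) Ei -Ev.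
Qed.

(** * Growth in free groups *)

Section Tripling.

(** The factor 16 is 8 from [compatible_subsets] times 2 from [median_split]; the
    factor 4 comes from [sandwich_dichotomy]. *)
Lemma tripling_bound N k t : N <= 16 * k -> k ^ 2 <= 4 * t -> N ^ 2 <= 1024 * t.
Proof. by rewrite -!mulnn; nia. Qed.

Definition triples (G : groupType) (A : seq G) :=
  undup [seq ab * c | ab <- [seq a * b | a <- A, b <- A], c <- A].

Lemma triplesP (G : groupType) (A : seq G) g :
  reflect (exists a b c, [/\ a \in A, b \in A, c \in A & g = a * b * c]) (g \in triples A).
Proof.
rewrite mem_undup; apply: (iffP allpairsP) => [[[ab c] /= [/allpairsP[[a b] /= [aA bA ->]] cA ->]]|].
  by exists a, b, c.
case=> a [b [c [aA bA cA ->]]]; exists (a * b, c); split=> //=.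
by apply/allpairsP; exists (a, b).
Qed.

Lemma size_triples_map (G H : groupType) (f : G -> H) (A : seq G) :
  {morph f : x y / x * y} -> size (triples (map f A)) <= size (triples A).
Proof.
move=> fM; rewrite -(size_map f (triples A)); apply: uniq_leq_size; first exact: undup_uniq.
move=> _ /triplesP[_ [_ [_ [/mapP[a aA ->] /mapP[b bA ->] /mapP[c cA ->] ->]]]].
by rewrite -!fM map_f //; apply/triplesP; exists a, b, c.
Qed.

Variable I : choiceType.
Implicit Types (A X Y : seq (fword I)) (a b c x y z : fword I).

(** Without cancellation, products of group elements are concatenations. The
    middle factor must be nontrivial, since otherwise [a] and [c] would meet. *)
Lemma sandwich_sub_triples A X b : b != 1 -> b \in A -> {subset X <= A} ->
  {in X, forall a, first_letter a^-1 != first_letter b /\ first_letter b^-1 != first_letter a} ->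
  size (sandwich (map val X) (map val X) (val b)) <= size (triples A).
Proof.
move=> nb bA sX H; rewrite -(size_map val (triples A)).
apply: uniq_leq_size; first exact: undup_uniq.
move=> g; rewrite mem_undup => /allpairsP[[_ _] /= [/mapP[a aX ->] /mapP[c cX ->] ->]].
have [Hab _] := H a aX; have [_ Hbc] := H c cX.
have Ebc : fval (b * c) = b ++ c by rewrite fval_cat // Hbc.
have Eabc : fval (a * (b * c)) = a ++ b ++ c.
  rewrite fval_cat ?Ebc // {2}/first_letter Ebc; apply/orP; left; move: Hab nb.
  by rewrite {2}/first_letter fword_eq1; case: (fval b).
rewrite -Eabc; apply/map_f/triplesP; exists a, b, c.
by rewrite mulgA; split=> //; apply: sX.
Qed.

Lemma coset_tripling A Y z b0 x : cyc_reduced z -> uniq Y -> {subset Y <= A} ->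
  {in Y, forall b, exists k, b = z ^+ k * b0} -> x \in A -> ~ commute (b0 * x) z ->
  size Y ^ 2 <= size (triples A).
Proof.
move=> cz UY sY HY xA nc; rewrite -mulnn -(size_allpairs (fun b b' => b * x * b') Y Y).
apply: uniq_leq_size; last first.
  move=> _ /allpairsP[[b b'] /= [bY b'Y ->]]; apply/triplesP.
  by exists b, x, b'; split=> //; apply: sY.
apply: allpairs_uniq => // -[b1 b2] [b1' b2'] /allpairsP[[? ?] /= [m1 m2 [-> ->]]].
case/allpairsP=> -[? ?] /= [m1' m2' [-> ->]].
have [k -> ] := HY _ m1; have [l -> ] := HY _ m2.
have [k' -> ] := HY _ m1'; have [l' -> ] := HY _ m2'.
rewrite !mulgA => /mulIg; rewrite -(mulgA _ b0 x) -(mulgA (z ^+ k') b0 x) => E.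
by have [-> ->] := sandwich_inj cz nc E.
Qed.

(** Taking [x = b0] shows that [b0 * b0], hence also [b0], commutes with [z];
    then so does each [x]. *)
Lemma coset_commute A z b0 : cyc_reduced z -> b0 != 1 -> b0 \in A ->
  {in A, forall x, commute (b0 * x) z} -> {in A &, forall x y, commute x y}.
Proof.
move=> cz nb bA H; have nz := cyc_reduced_neq1 cz.
have nbb : b0 * b0 != 1.
  by apply: contra_neq nb => E; apply: (@pow_eq1 _ _ 1); rewrite expg2.
have cb : commute b0 z.
  have cbb : commute b0 (b0 * b0) by apply: commuteM.
  exact: commute_trans nbb cbb (commute_sym (H _ bA)).
have cA : {in A, forall x, commute x z}.
  move=> x xA; apply: (mulgI b0); rewrite !mulgA.
  by rewrite [b0 * z]cb [LHS](H x xA) mulgA.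
by move=> x y xA yA; apply: commute_trans nz (cA _ xA) (cA _ yA).
Qed.

Theorem free_tripling A : uniq A -> ~ {in A &, forall x y, commute x y} ->
  size A ^ 2 <= 1024 * size (triples A).
Proof.
wlog bal : A / forall l, count (fun x => first_letter x == Some l) A
    + count (fun x => first_letter x^-1 == Some l) A <= size A => [W UA ncA|UA ncA].
  have [g Hg] := min_conj A; pose f x := x ^ g.
  have le := @size_triples_map _ _ f A (fun x y => conjMg x y g).
  apply: leq_trans (leq_mul (leqnn 1024) le); rewrite -(size_map f A).
  apply: W => [l||cA]; first by rewrite !count_map size_map; apply: Hg.
    by rewrite map_inj_uniq //; apply: conjg_inj.
  apply: ncA => x y xA yA; apply: (conjg_inj g); rewrite !conjMg.
  by apply: cA; apply: map_f.
(* Small sets satisfy the bound since [A^3] is not empty. Beyond that size the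
   subset [X'] below has two elements, so that the elements of [Y'], being at
   least as long, are nontrivial. *)
have [le_32|lt_32] := leqP (size A) 32.
  apply: (@leq_trans 1024); first by rewrite -mulnn; apply: (leq_mul le_32 le_32).
  case: A UA ncA {bal le_32} => [|x A] _ nc; first by case: nc.
  rewrite -[1024]muln1 leq_mul2l lt0n size_eq0 /=.
  have : x * x * x \in triples (x :: A).
    by apply/triplesP; exists x, x, x; rewrite mem_head.
  by case: triples.
(* The identity has no first letter. Counting [None] as a vertex, its degree is
   at most 2. *)
have bal' t : count (fun x => first_letter x == t) A + count (fun x => first_letter x^-1 == t) A <= size A.
  case: t => [l|]; first exact: bal.
  have c1 : count (pred1 1) A <= 1 by rewrite count_uniq_mem //; case: (_ \in _).
  have E1 : count (fun x => first_letter x == None) A = count (pred1 1) A.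
    by apply: eq_count => x /=; rewrite fword_eq1 /first_letter; case: (fval x).
  rewrite E1 (@eq_count _ (fun x => first_letter x^-1 == None) (pred1 1)).
    by apply: leq_trans (leq_add c1 c1) _; apply: leq_trans lt_32.
  by move=> x /=; rewrite -invg_eq1 fword_eq1 /first_letter; case: (fval x^-1).
have [X [Y [[UX UY] [sX sY] [sizeX sizeY] HXY]]] := compatible_subsets UA bal'.
have [X' [Y' [[UX' UY'] sub [szX szY] le]]] := median_split (fun x => size x) UX UY.
have {bal bal'} [sX' sY' H] : [/\ {subset X' <= A}, {subset Y' <= A} &
    {in X' & Y', forall a b, first_letter a^-1 != first_letter b /\ first_letter b^-1 != first_letter a}].
  case: sub => -[s1 s2]; split.
  - by move=> a /s1/sX.
  - by move=> a /s2/sY.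
  - by move=> a b /s1 aX /s2 bY; apply: HXY.
  - by move=> a /s1/sY.
  - by move=> a /s2/sX.
  - by move=> a b /s1 aY /s2 bX; have [] := HXY _ _ bX aY.
have sizeXY : size A <= 8 * minn (size X) (size Y) by rewrite /minn; case: ifP.
have lX : size A <= 16 * size X'.
  by apply: leq_trans sizeXY _; rewrite -[16]/(8 * 2)%N -mulnA leq_mul2l szX orbT.
have lY : size A <= 16 * size Y'.
  by apply: leq_trans sizeXY _; rewrite -[16]/(8 * 2)%N -mulnA leq_mul2l szY orbT.
have nY b : b \in Y' -> b != 1.
  move=> bY; apply: contraTneq isT => b1.
  have X1 : {subset X' <= [:: 1]}.
    by move=> a aX; have := le _ _ aX bY; rewrite b1 leqn0 -fword_eq1 inE.
  have lA := leq_trans lX (leq_mul (leqnn 16) (uniq_leq_size UX' X1)).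
  by have := leq_trans lt_32 lA.
have [|||] := @sandwich_dichotomy _ (map val X') (map val Y').
- by rewrite map_inj_uniq //; apply: val_inj.
- by move=> _ _ /mapP[a aX ->] /mapP[b bY ->]; apply: le.
- case=> _ /mapP[b bY ->]; rewrite size_map => le4.
  have le1 : size (sandwich (map val X') (map val X') (val b)) <= size (triples A).
    by apply: sandwich_sub_triples (nY b bY) (sY' _ bY) sX' _ => a aX; apply: H.
  exact: tripling_bound lX (leq_trans le4 (leq_mul (leqnn 4) le1)).
case=> pre Hpow.
have Y0 : Y' != [::].
  by apply: contraTneq lY => ->; rewrite -ltnNge; apply: leq_trans lt_32.
have ex_n : exists n, has (fun b => size b == n) Y'.
  by exists (size (head 1 Y')); case: (Y') Y0 => //= b Y'' _; rewrite eqxx.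
case: (ex_minnP ex_n) => n /hasP[b0 b0Y /eqP sb0] min_n.
have minb0 : {in Y', forall b, size b0 <= size b}.
  by move=> b bY; rewrite sb0; apply: min_n; apply/hasP; exists b.
have n0 := nY _ b0Y; have s0 : 0 < size b0 by rewrite lt0n -fword_eq1.
have prez := pre _ (map_f val b0Y).
have redzz := reduced_prefix prez (fvalP b0).
have redz : freely_reduced (period_word (val b0)).
  by apply: reduced_prefix redzz; rewrite wpowS prefix_prefix.
pose z : fword I := Fword redz.
have nz : z != 1.
  rewrite fword_eq1 -lt0n [fval z]/(period_word (val b0)) size_take.
  by case: ifP => _ //; apply: minper_gt0.
have cz : cyc_reduced z.
  have := redzz; rewrite /wpow /= cats0; apply: reduced_cat_junction.
  by move: nz; rewrite fword_eq1 size_eq0.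
have Hz : {in Y', forall b, exists k, b = z ^+ k * b0}.
  move=> b bY; have [k Ek] := Hpow _ _ (map_f val b0Y) (map_f val bY) (minb0 _ bY).
  exists k; apply: val_inj; rewrite Ek -[RHS]/(wmul (fval (z ^+ k)) (fval b0)).
  by rewrite fval_pow // wmul_cat // -Ek; apply: fvalP.
case: (boolP (all (fun x => b0 * x * z == z * (b0 * x)) A)) => [/allP Hc|/allPn[x xA /eqP nc]].
  by case: ncA; apply: coset_commute cz n0 (sY' _ b0Y) _ => x /Hc/eqP.
apply: tripling_bound lY (leq_trans (coset_tripling cz UY' sY' Hz xA nc) _).
exact: leq_pmull.
Qed.
End Tripling.

(** * Finitely generated torsion-free abelian groups *)

Section Zpow.
Variable G : groupType.
Implicit Types (x y : G) (k : int).

Definition zpow x k := match k with Posz n => x ^+ n | Negz n => x ^- n.+1 end.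

(** Writing integers as differences of natural numbers avoids a discussion of
    signs in [zpowD]. *)
Lemma zpow_sub x m n : zpow x (m%:Z - n%:Z)%R = x ^+ m * x ^- n.
Proof.
have [le|/ltnW le] := leqP n m; first by rewrite subzn //= expgnFr.
rewrite -[(_ - _)%R]opprK opprB subzn // -{2}(subnK le) expgnDr invgM mulVKg.
by case: (n - m)%N => [|d] //=; rewrite invg1.
Qed.

Lemma zpowD x : {morph zpow x : a b / (a + b)%R >-> a * b}.
Proof.
have split a : exists m n, a = (m%:Z - n%:Z)%R.
  by case: a => n; [exists n, 0; rewrite subr0 | exists 0, n.+1; rewrite sub0r NegzE].
move=> a b; have [m [n ->]] := split a; have [m' [n' ->]] := split b.
have -> : (m%:Z - n%:Z + (m'%:Z - n'%:Z) = (m + m')%N%:Z - (n' + n)%N%:Z)%R.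
  by rewrite !PoszD opprD addrACA [(- n'%:Z - _)%R]addrC.
rewrite !zpow_sub !expgnDr invgM -!mulgA; congr (x ^+ m * _).
rewrite !mulgA; congr (_ * _).
by apply/commute_sym/commute_sym/commuteV/commute_sym/commuteX/commute_sym/commuteX.
Qed.

Lemma commute_zpow x y a b : commute x y -> commute (zpow x a) (zpow y b).
Proof.
move=> c; have C u v (d : int) : commute u v -> commute u (zpow v d).
  by move=> cuv; case: d => n /=; [|apply: commuteV]; apply: commuteX.
by apply/C/commute_sym/C/commute_sym.
Qed.

Lemma zpow1g k : zpow (1 : G) k = 1.
Proof. by case: k => n /=; rewrite expg1n ?invg1. Qed.

End Zpow.

Section AdditiveToMultiplicative.
Variables (V : zmodType) (G : groupType) (f : V -> G).
Hypothesis fD : forall u v, f (u + v)%R = f u * f v.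

Lemma hom0 : f 0%R = 1.
Proof. by apply: (mulgI (f 0%R)); rewrite -fD addr0 mulg1. Qed.

Lemma homN u : f (- u)%R = (f u)^-1.
Proof. by apply: (mulgI (f u)); rewrite -fD subrr hom0 mulgV. Qed.

Lemma homMn u n : f (u *+ n)%R = f u ^+ n.
Proof. by elim: n => [|n IH]; rewrite ?mulr0n ?hom0 // mulrS fD IH expgS. Qed.

Lemma homMz u (k : int) : f (u *~ k)%R = zpow (f u) k.
Proof. by case: k => n; rewrite ?NegzE ?mulrNz ?homN -?pmulrn homMn. Qed.
End AdditiveToMultiplicative.

Definition torsion_free (G : groupType) := forall (g : G) n, g ^+ n.+1 = 1 -> g = 1.

Lemma zpow_eq1 (G : groupType) (g : G) k : torsion_free G -> (k != 0)%R ->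
  zpow g k = 1 -> g = 1.
Proof.
move=> tf; case: k => [[|n]|n] //= _; first exact: tf.
by move/eqP; rewrite invg_eq1 => /eqP; apply: tf.
Qed.

Section LatticeHom.
Variable G : groupType.
Hypothesis tfG : torsion_free G.

(** By the Smith normal form of the row [u], it is a nonzero multiple of the
    first row [w] of an invertible matrix [R]. As [G] is torsion-free, [f] kills
    [w]. The rows of [R] form a basis, so that the rows other than [w] already
    generate the image. *)
Lemma kernel_drop n (f : 'rV[int]_n.+1 -> G) (u : 'rV[int]_n.+1) :
  (forall u v, f (u + v)%R = f u * f v) -> (u != 0)%R -> f u = 1 ->
  exists f' : 'rV[int]_n -> G, (forall u v, f' (u + v)%R = f' u * f' v) /\
    (forall g, (exists v, f v = g) <-> (exists v, f' v = g)).
Proof.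
move=> fD nu fu; have [L _ [R Ru [d _ Eu]]] := int_Smith_normal_form u.
pose w : 'rV_n.+1 := row 0%R R.
have Ew : (\matrix_(i < 1, j < n.+1) (d`_i *+ (i == j :> nat)) *m R = d`_0 *: w)%R.
  apply/rowP => j; rewrite !mxE big_ord_recl big1 ?addr0 => [|i _]; rewrite !mxE //=.
  by rewrite mulr0n mul0r.
have Ecw : (u = (L 0 0 * d`_0) *: w)%R.
  by rewrite Eu {1}[L]mx11_scalar mul_scalar_mx -scalemxAl Ew scalerA.
have nc : (L 0 0 * d`_0 != 0)%R.
  by apply: contraNneq nu => c0; rewrite Ecw c0 scale0r.
have fw : f w = 1.
  by apply: zpow_eq1 tfG nc _; rewrite -(homMz fD) -scaler_int intz -Ecw.
pose f' (v : 'rV[int]_n) := f (row_mx (0 : 'M_1) v *m R)%R.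
have f'D u' v : f' (u' + v)%R = f' u' * f' v.
  by rewrite /f' -fD -mulmxDl add_row_mx addr0.
exists f'; split=> // g; split=> [[x <-]|[v <-]]; last by eexists.
pose y : 'rV_(1 + n) := (x *m invmx R)%R; exists (rsubmx y).
have Ey : (y = (y 0 0) *: delta_mx 0 0 + row_mx (0 : 'M_1) (rsubmx y))%R.
  apply/rowP => j; rewrite !mxE; case: splitP => k Ek.
    have -> : j = 0%R by apply: val_inj; rewrite /= Ek ord1.
    by rewrite mxE eqxx mulr1 addr0.
  have -> : j = rshift 1 k by apply: val_inj.
  by rewrite !mxE mulr0 add0r.
have Ex : (x = (y 0 0) *: w + row_mx (0 : 'M_1) (rsubmx y) *m R)%R.
  by rewrite -[LHS](mulmxKV Ru) -/y {1}Ey mulmxDl -scalemxAl -rowE.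
by rewrite Ex fD -[y 0%R 0%R]intz scaler_int (homMz fD) fw zpow1g mul1g.
Qed.

(** The rank is lowered as long as there is a nonzero vector in the kernel. *)
Lemma injective_lattice_hom n (f : 'rV[int]_n -> G) :
  (forall u v, f (u + v)%R = f u * f v) ->
  exists m (f' : 'rV[int]_m -> G), [/\ forall u v, f' (u + v)%R = f' u * f' v,
    injective f' & forall g, (exists v, f v = g) <-> (exists v, f' v = g)].
Proof.
elim: n f => [|n IH] f fD.
  by exists 0, f; split=> // u v _; rewrite (thinmx0 u) (thinmx0 v).
case: (classic (exists u, (u != 0)%R /\ f u = 1)) => [[u [nu fu]]|noker].
  have [f1 [f1D im1]] := kernel_drop fD nu fu.
  have [m [f2 [f2D inj2 im2]]] := IH f1 f1D.
  by exists m, f2; split=> // g; rewrite im1.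
exists n.+1, f; split=> // u v Euv; apply/eqP; rewrite -subr_eq0.
apply/negPn/negP => nuv; apply: noker; exists (u - v)%R; split=> //.
by rewrite fD (homN fD) Euv mulgV.
Qed.

Lemma lattice_image_free_abelian n (f : 'rV[int]_n -> G) (S : G -> Prop) :
  (forall u v, f (u + v)%R = f u * f v) -> (forall g, S g <-> exists v, f v = g) ->
  is_free_abelian_subgroup S.
Proof.
move=> fD imf; have [m [f' [f'D inj' im']]] := injective_lattice_hom fD.
pose coords (D : {freeg 'I_m}) : 'rV[int]_m := (\row_i coeff i D)%R.
exists 'I_m, (fun D => f' (coords D)); split=> [D E|D E /inj' /rowP ER|g].
- by rewrite -f'D; congr f'; apply/rowP => i; rewrite !mxE coeffD.
- by apply/eqP/freeg_eqP => i; have := ER i; rewrite !mxE.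
rewrite imf im'; split=> [[v <-]|[D <-]]; last by eexists.
exists (\sum_i << v 0%R i *g i >>)%R; congr f'; apply/rowP => j.
rewrite mxE raddf_sum (bigD1 j) //= coeffU eqxx mulr1 big1 ?addr0 // => i nij.
by rewrite coeffU (negPf nij) mulr0.
Qed.

Lemma generated_free_abelian (A : {fset G}) : {in A &, forall x y, commute x y} ->
  is_free_abelian_subgroup (generated A).
Proof.
move=> cA; pose n := size (enum_fset A); pose a (i : 'I_n) := tnth (in_tuple (enum_fset A)) i.
have aA i : a i \in A by apply: mem_tnth.
pose f (v : 'rV[int]_n) := \prod_(i < n) zpow (a i) (v 0%R i).
have fD u v : f (u + v)%R = f u * f v.
  rewrite /f -prodgM_commute => [|i j _ _]; last by apply/commute_zpow/cA.
  by apply: eq_bigr => i _; rewrite mxE zpowD.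
apply: (lattice_image_free_abelian fD) => g; split=> [|[v <-]].
  elim=> [b bA||b c _ [u <-] _ [v <-]|b _ [u <-]].
  - have /tnthP[i Ei] : b \in in_tuple (enum_fset A) by [].
    exists (delta_mx 0 i)%R; rewrite /f.
    rewrite (eq_bigr (fun j => if j == i then a j else 1)) => [|j _].
      by rewrite -big_mkcond big_pred1_eq Ei.
    by rewrite mxE eqxx /=; case: eqP.
  - by exists 0%R; rewrite (hom0 fD).
  - by exists (u + v)%R; rewrite fD.
  - by exists (- u)%R; rewrite (homN fD).
apply: big_ind => [|x y|i _]; [exact: generated_one|exact: generated_mul|].
have gX k : generated A (a i ^+ k).
  by elim: k => [|k IH]; [exact: generated_one|rewrite expgS; apply: generated_mul => //; exact: generated_mem].
by case: (v _ i) => k //=; apply: generated_inv.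
Qed.
End LatticeHom.

(** * Fully residually free groups *)

Lemma uniq_map_injective (S U : eqType) (h : S -> U) (s : seq S) :
  uniq (map h s) -> {in s &, injective h}.
Proof.
elim: s => [|z s IH] //= /andP[nz /IH inj] x y.
rewrite !inE => /predU1P[->|xs] /predU1P[->|ys] //; last exact: inj.
  by move=> E; rewrite E map_f in nz.
by move=> E; rewrite -E map_f in nz.
Qed.

Lemma fully_residually_free_fword (G : groupType) (s : seq G) :
  fully_residually_free G -> uniq s ->
  exists I (psi : G -> fword I), {morph psi : x y / x * y} /\ {in s &, injective psi}.
Proof.
move=> hG /hG[F [theta [/free_group_embedding[I [phi inj_phi]] _ Ut]]].
exists I, (fun g => phi (theta g)); split=> [x y|]; first by rewrite !gmulfM.
have : uniq [seq phi (theta g) | g <- s] by rewrite (map_comp phi) map_inj_uniq.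
exact: uniq_map_injective.
Qed.

Lemma fully_residually_free_torsion_free (G : groupType) :
  fully_residually_free G -> torsion_free G.
Proof.
move=> hG g n gn; apply/eqP/negPn/negP => ng.
have U : uniq [:: g; 1] by rewrite /= inE ng.
have [I [psi [psiM inj]]] := fully_residually_free_fword hG U.
have psi1 : psi 1 = 1 by apply: (mulgI (psi 1)); rewrite -psiM !mulg1.
have psiX k : psi (g ^+ k) = psi g ^+ k.
  by elim: k => [|k IH]; rewrite ?psi1 // !expgS psiM IH.
have /pow_eq1 E : psi g ^+ n.+1 = 1 by rewrite -psiX gn psi1.
by case/eqP: ng; apply: inj; rewrite ?inE ?eqxx ?orbT // E psi1.
Qed.

Lemma size_triples_fset (G : groupType) (A : {fset G}) :
  size (triples (enum_fset A)) <= #|` triple_prod A|.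
Proof.
apply: uniq_leq_size; first exact: undup_uniq.
move=> _ /triplesP[a [b [c [aA bA cA ->]]]].
by apply/imfset2P; exists (a * b); [apply/imfset2P; exists a => //; exists b | exists c].
Qed.

Theorem corollary3p2 (G : groupType) (A : {fset G})
    (hG : fully_residually_free G) (hA : A != fset0%fset) :
  (1 / 7776 * (#|` A|%:R : rat) ^+ 2 <= #|` triple_prod A|%:R)%R
  \/ is_free_abelian_subgroup (generated A).
Proof.
have [/allrelP cA|] := boolP (all2rel (fun x y => x * y == y * x) (enum_fset A)).
  right; apply: generated_free_abelian; first exact: fully_residually_free_torsion_free.
  by move=> x y xA yA; apply/eqP/cA.
case/allPn=> x xA /allPn[y yA /eqP nc]; left.
(* Listing [x * y] and [y * x] along with [A] keeps them distinct in the free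
   group, so that the image of [A] does not commute either. *)
have U : uniq (undup (x * y :: y * x :: enum_fset A)) by apply: undup_uniq.
have [I [psi [psiM inj]]] := fully_residually_free_fword hG U.
have {}inj : {in x * y :: y * x :: enum_fset A &, injective psi}.
  by move=> u v us vs; apply: inj; rewrite mem_undup.
have UA : uniq (map psi (enum_fset A)).
  rewrite map_inj_in_uniq ?fset_uniq // => u v uA vA; apply: inj.
    by rewrite !inE [u \in _]uA !orbT.
  by rewrite !inE [v \in _]vA !orbT.
have ncA : ~ {in map psi (enum_fset A) &, forall u v, commute u v}.
  move=> cA; apply: nc; apply: inj; rewrite ?inE ?eqxx ?orbT // !psiM.
  by apply: cA; apply: map_f.
have bound : #|` A| ^ 2 <= 1024 * #|` triple_prod A|.
  have := free_tripling UA ncA; rewrite size_map => /leq_trans-> //.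
  rewrite leq_mul2l /=; apply: leq_trans (size_triples_fset A).
  exact: size_triples_map.
have {bound} : ((#|` A| ^ 2)%:R <= (1024 * #|` triple_prod A|)%:R :> rat)%R by rewrite ler_nat.
have := ler0n rat #|` triple_prod A|; rewrite natrX natrM; move: (_ ^+ 2)%R => N2.
by move: (_%:R)%R => T; lra.
Qed.
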